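(* Let $n\geqslant 1$ and $m\geqslant 1$ be integers and let $a_1,\ldots,a_n\in\mathbb{C}$. Then $$\Big(\prod_{1\leqslant i<j\leqslant n}(x_j-x_i)^{2m-1}\Big)^*(x-n+1,\ldots,x)=(-1)^{(m-1)\binom n2}\frac{m!(2m)!\cdots(nm)!}{(m!)^n n!}\times\frac{(x)_0(x)_m\cdots(x)_{(n-1)m}}{(x)_0(x)_1\cdots(x)_{n-1}},$$ where the left side is evaluated at $x_i=x-n+i$ for $i=1,\ldots,n$, and $$\Big(\prod_{1\leqslant i<j\leqslant n}(a_jx_j-a_ix_i)(x_j-x_i)^{2m-1}\Big)^*(x,\ldots,x)=(-1)^{m\binom n2}\frac{m!(2m)!\cdots(nm)!}{(m!)^n n!}\,\mathrm{per}(a_j^{i-1})_{1\leqslant i,j\leqslant n}\prod_{r=0}^{n-1}(x)_{rm}.$$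
   Context: $(x)_0=1$ and $(x)_r=x(x-1)\cdots(x-r+1)$ for positive integers $r$. For a polynomial $Q=\sum_{j_1,\ldots,j_n} c_{j_1,\ldots,j_n}x_1^{j_1}\cdots x_n^{j_n}\in\mathbb{C}[x_1,\ldots,x_n]$, $Q^*$ denotes $\sum_{j_1,\ldots,j_n} c_{j_1,\ldots,j_n}(x_1)_{j_1}\cdots(x_n)_{j_n}$. $\mathrm{per}(b_{ij})_{1\leqslant i,j\leqslant n}=\sum_{\sigma\in S_n}\prod_{i=1}^n b_{i,\sigma(i)}$ is the permanent. *)

(* Defs.v *)
From HB Require Import structures.
From mathcomp Require Import all_boot all_order all_algebra all_fingroup.
From mathcomp Require Import reals.
From mathcomp Require Import complex.
From mathcomp Require Import mpoly.
Set Implicit Arguments. Unset Strict Implicit. Unset Printing Implicit Defensive.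
Import Order.TTheory GRing.Theory Num.Theory.
Local Open Scope ring_scope.

Definition ffact (S : pzRingType) (x : S) (r : nat) : S :=
  \prod_(k < r) (x - k%:R).

(* Q^* evaluated at v : for Q = sum c_j x^j, Q^*(v) = sum c_j (v_1)_{j_1}...(v_n)_{j_n}.
   Coefficients in F are embedded as constant polynomials, so v takes values in {poly F}. *)
Definition star_eval (F : fieldType) (n : nat) (Q : {mpoly F[n]})
    (v : 'I_n -> {poly F}) : {poly F} :=
  \sum_(mo <- msupp Q) (Q@_mo)%:P * \prod_(i < n) ffact (v i) (mo i).

Definition per (F : pzRingType) (n : nat) (B : 'M[F]_n) : F :=
  \sum_(s : 'S_n) \prod_(i < n) B i (s i).

(* Main.v *)
Require Import Defs.
From HB Require Import structures.
From mathcomp Require Import all_boot all_order all_algebra all_fingroup.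
From mathcomp Require Import reals.
From mathcomp Require Import complex.
From mathcomp Require Import mpoly.
From mathcomp Require Import bigenough ssrcomplements ring.
Import Order.TTheory GRing.Theory Num.Theory.
Import BigEnough.
Local Open Scope ring_scope.

Set Implicit Arguments.
Unset Strict Implicit.

(** The evaluation Q |-> Q^*(x, ..., x) behaves like an expectation: with
    x = -a, (-1)^j (x)_j is the j-th moment of the Gamma(a) law.  So both
    identities reduce to the Laguerre form of the Selberg integral, that is, to
    D_n(x) := P^*(x, ..., x) for P = prod_(i <> j) (X_i - X_j)^m.
    From (x)_(j+1) = (x - j) (x)_j one gets "integration by parts",
    (X_i Q)^* = x Q^* - (X_i dQ/dX_i)^*, and Aomoto's argument gives, for k not
    in A, (X_k X_A P)^* = (x - m(n-1-|A|)) (X_A P)^*.  On the other hand a factor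
    X_i only shifts the i-th argument, so x^n D_n(x-1) = prod_(j<n) (x - jm) D_n(x),
    whence D_n = C_n prod_(r<n) (x)_(rm).  Taking A = {1, ..., n} in n+1 variables,
    dividing by x^n and setting x = 0 specializes X_0 to 0 and relates C_(n+1) to C_n.
    Finally the odd power of the Vandermonde product is alternating, so that only
    its product with prod_i X_i^i matters: expanding a Vandermonde determinant
    produces the permanent, and the shifted arguments of the first identity
    amount to multiplying by X_0^(n-1) X_1^(n-2) ... X_(n-1)^0. *)

(** * Falling factorials and the evaluation of Q^* *)

Section FallingFactorial.
Variable S : comNzRingType.
Implicit Type x : S.

Lemma ffact0 x : ffact x 0 = 1.
Proof. by rewrite /ffact big_ord0. Qed.

Lemma ffactS x r : ffact x r.+1 = ffact x r * (x - r%:R).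
Proof. by rewrite /ffact big_ord_recr. Qed.

Lemma ffactD x r s : ffact x (r + s) = ffact x r * ffact (x - r%:R) s.
Proof.
elim: s => [|s IH]; first by rewrite addn0 ffact0 mulr1.
by rewrite addnS !ffactS IH -mulrA natrD opprD addrA.
Qed.

Lemma ffact_recl x r : ffact x r.+1 = x * ffact (x - 1) r.
Proof. by rewrite -add1n ffactD ffactS ffact0 mul1r subr0. Qed.

Lemma ffact0l r : ffact 0 r = (r == 0%N)%:R :> S.
Proof. by case: r => [|r]; rewrite ?ffact0 // ffact_recl mul0r. Qed.

(** The factorials in the final constant come from evaluating falling factorials at [-1]. *)
Lemma ffactN1 r : ffact (-1) r = (-1) ^+ r * r`!%:R :> S.
Proof.
elim: r => [|r IH]; first by rewrite ffact0 expr0 mul1r.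
by rewrite ffactS IH exprS factS natrM -natr1; ring.
Qed.

Lemma rmorph_ffact (S' : comNzRingType) (f : {rmorphism S -> S'}) x r :
  f (ffact x r) = ffact (f x) r.
Proof.
by rewrite /ffact rmorph_prod; apply: eq_bigr => k _; rewrite rmorphB rmorph_nat.
Qed.

End FallingFactorial.

Section Star.
Variables (F : fieldType) (n : nat).
Implicit Types (p q : {mpoly F[n]}) (v : 'I_n -> {poly F}) (x : {poly F}).

Definition star v p := star_eval p v.

(** An index set that does not depend on the support of [p] makes linearity a termwise check. *)
Lemma star_widen k v p : (msize p <= k)%N ->
  star v p = \sum_(m : 'X_{1..n < k}) (p@_m)%:P * \prod_(i < n) ffact (v i) (m i).
Proof.
move=> le_pk; pose I : subFinType _ := 'X_{1..n < k}.
rewrite /star /star_eval (big_mksub I) ?msupp_uniq //=; last first.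
  by move=> m /msize_mdeg_lt /leq_trans; apply.
by rewrite big_rmcond //= => j /memN_msupp_eq0 ->; rewrite mul0r.
Qed.

Fact star_is_linear v : linear (star v).
Proof.
move=> c p q; pose_big_enough k.
  rewrite !(@star_widen k) // scaler_sumr -big_split; apply: eq_bigr => m _ /=.
  by rewrite mcoeffD mcoeffZ rmorphD rmorphM mulrDl /= -mulrA mul_polyC.
by close.
Qed.

HB.instance Definition _ v :=
  GRing.isLinear.Build F {mpoly F[n]} {poly F} *:%R (star v) (star_is_linear v).

Lemma starD v p q : star v (p + q) = star v p + star v q.
Proof. exact: linearD. Qed.

Lemma starZ v c p : star v (c *: p) = c *: star v p.
Proof. exact: linearZ. Qed.

Lemma star0 v : star v 0 = 0.
Proof. exact: linear0. Qed.

Lemma star_sum v (I : finType) (Q : pred I) (f : I -> {mpoly F[n]}) :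
  star v (\sum_(i | Q i) f i) = \sum_(i | Q i) star v (f i).
Proof. exact: linear_sum. Qed.

Lemma starX v m : star v 'X_[m] = \prod_(i < n) ffact (v i) (m i).
Proof. by rewrite /star /star_eval msuppX big_seq1 mcoeffX eqxx mul1r. Qed.

Lemma eq_star v w p : v =1 w -> star v p = star w p.
Proof.
move=> vw; rewrite /star /star_eval.
by apply: eq_bigr => m _; congr (_ * _); apply: eq_bigr => i _; rewrite vw.
Qed.

Lemma star_msym v s p : star v (msym s p) = star (fun i => v (s i)) p.
Proof.
elim/mpolyind: p => [|c m p _ _ IH]; first by rewrite msym0 !star0.
rewrite msymD msymZ !starD !starZ IH msymX !starX; congr (_ *: _ + _).
rewrite [LHS](reindex_inj (@perm_inj _ s)) /=.
by apply: eq_bigr => i _; rewrite mnmE permK.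
Qed.

(** On monomials this is [ffactD]: the first [e i] factors split off and the remaining ones start at
    [v i - e i]. *)
Lemma star_mulX v e p :
  star v ('X_[e] * p) =
  \prod_(i < n) ffact (v i) (e i) * star (fun i => v i - (e i)%:R) p.
Proof.
elim/mpolyind: p => [|c m p _ _ IH]; first by rewrite mulr0 !star0 mulr0.
rewrite mulrDr -scalerAr !starD !starZ IH -mpolyXD !starX mulrDr -scalerAr.
congr (_ *: _ + _); rewrite -big_split; apply: eq_bigr => i _.
by rewrite mnmDE ffactD.
Qed.

(** On a monomial, ['X_i] times the derivative multiplies by [m i], and [(v_i)_(m_i + 1) = (v_i -
    m_i) (v_i)_(m_i)]. *)
Lemma star_mderiv v i p :
  star v ('X_i * p) = v i * star v p - star v ('X_i * p^`M(i)).
Proof.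
elim/mpolyind: p => [|c m p _ _ IH].
  by rewrite mderiv0 !mulr0 !star0 mulr0 subr0.
rewrite mderivD mderivZ !mulrDr -!scalerAr !starD !starZ IH mulrDr -scalerAr.
rewrite opprD addrACA -scalerBr; congr (_ *: _ + _).
rewrite -mpolyXD mderivX -scalerAr starZ -mpolyXD !starX.
pose split_i (E : 'X_{1..n}) := bigD1 (P := xpredT)
  (F := fun j => ffact (v j) (E j)) i isT.
rewrite !split_i /= !mnmDE !mnm1E eqxx !add1n ffactS.
have off E : \prod_(j < n | j != i) ffact (v j) ((U_(i) + E)%MM j)
   = \prod_(j < n | j != i) ffact (v j) (E j).
  apply: eq_bigr => j ji; congr ffact.
  by rewrite mnmDE mnm1E eq_sym (negPf ji).
have offm : \prod_(j < n | j != i) ffact (v j) ((m - U_(i))%MM j)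
   = \prod_(j < n | j != i) ffact (v j) (m j).
  apply: eq_bigr => j ji; congr ffact.
  by rewrite mnmBE mnm1E eq_sym (negPf ji) subn0.
rewrite !off offm mnmBE mnm1E eqxx.
set Q := \prod_(_ < _ | _) _; rewrite -mul_polyC.
(* When [m i = 0], the truncated exponent of the derivative is harmless, since its coefficient
   vanishes. *)
rewrite polyC_natr; case: (m i) => [|k]; first by rewrite ffact0; ring.
by rewrite subn1 /=; ring.
Qed.

End Star.

Lemma star_comp (F : fieldType) n (v : 'I_n -> {poly F}) (p : {mpoly F[n]}) q :
  star v p \Po q = star (fun i => v i \Po q) p.
Proof.
rewrite /star /star_eval rmorph_sum; apply: eq_bigr => m _ /=.
rewrite rmorphM /= comp_polyC rmorph_prod; congr (_ * _).
by apply: eq_bigr => i _ /=; rewrite rmorph_ffact.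
Qed.

(** * Setting the first variable to zero *)

Definition mnm_lift n (m : 'X_{1..n.+1}) : 'X_{1..n} := [multinom m (lift ord0 i) | i < n].

Definition specialize0 (F : fieldType) n (p : {mpoly F[n.+1]}) : {mpoly F[n]} :=
  p \mPo [tuple if unlift ord0 i is Some j then 'X_j else 0 | i < n.+1].

(** Since [(0)_r] is [1] for [r = 0] and [0] otherwise, exactly like [0 ^+ r], a zero argument kills
    the same monomials as substituting [0] for the variable. *)
Lemma star_specialize0 (F : fieldType) n (v : 'I_n.+1 -> {poly F}) p :
  v ord0 = 0 -> star v p = star (fun i => v (lift ord0 i)) (specialize0 p).
Proof.
move=> v0; rewrite /specialize0.
elim/mpolyind: p => [|c m p _ _ IH]; first by rewrite comp_mpoly0 !star0.
rewrite comp_mpolyD comp_mpolyZ !starD !starZ IH; congr (_ *: _ + _).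
rewrite starX comp_mpolyX big_ord_recl v0 ffact0l.
rewrite big_ord_recl tnth_mktuple unlift_none expr0n.
under [in RHS]eq_bigr => i _ do rewrite tnth_mktuple liftK.
case: eqP => _; last by rewrite !mul0r linear0.
rewrite !mul1r.
transitivity (star (fun i => v (lift ord0 i)) 'X_[mnm_lift m]).
  by rewrite starX; apply: eq_bigr => i _; rewrite mnmE.
by congr star; rewrite mpolyXE_id; apply: eq_bigr => i _; rewrite mnmE.
Qed.

(** * Aomoto's recurrence *)

Section MpolyExtra.
Variables (R : idomainType) (n : nat).
Implicit Types p : {mpoly R[n]}.

Lemma mderivXU k i : ('X_i : {mpoly R[n]})^`M(k) = (i == k)%:R.
Proof.
rewrite mderivX mnm1E; case: eqP => [->|_]; last by rewrite scale0r.
have -> : (U_(k) - U_(k) = 0)%MM by apply/mnmP => j; rewrite mnmBE subnn mnm0E.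
by rewrite mpolyX0 scale1r.
Qed.

Lemma mderivXn k p m : (p ^+ m)^`M(k) = m%:R * p ^+ m.-1 * p^`M(k).
Proof.
elim: m => [|m IH]; first by rewrite expr0 -[1]/(1%:MP) mderivC !mul0r.
rewrite exprS mderivM IH -natr1 /=; case: m {IH} => [|m] /=; first ring.
by rewrite exprS; ring.
Qed.

Lemma mderiv_prod k (I : finType) (P : pred I) (f : I -> {mpoly R[n]}) :
  (\prod_(i | P i) f i)^`M(k) =
  \sum_(i | P i) (f i)^`M(k) * \prod_(j | P j && (j != i)) f j.
Proof.
elim: (index_enum I) (index_enum_uniq I) => [|i s IH] /=.
  by rewrite !big_nil -[1]/(1%:MP) mderivC.
move=> /andP[i_s /IH {}IH]; rewrite !big_cons.
(* Uniqueness of the enumeration keeps the head index apart from the later ones. *)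
have off j : j \in s -> i != j by apply: contraTneq => <-.
case: ifP => Pi; last first.
  by rewrite IH; apply: eq_bigr => j _; rewrite big_cons Pi.
rewrite mderivM IH eqxx /=; congr (_ * _ + _).
  rewrite big_seq_cond [RHS]big_seq_cond; apply: eq_bigl => j.
  by case: (boolP (j \in s)) => //= /off; rewrite eq_sym => ->; rewrite andbT.
rewrite mulr_sumr big_seq_cond [RHS]big_seq_cond.
apply: eq_bigr => j /andP[/off ij _].
by rewrite big_cons Pi ij /= mulrCA.
Qed.

Lemma msymXU (s : 'S_n) i : msym s ('X_i : {mpoly R[n]}) = 'X_(s i).
Proof.
rewrite msymX; congr mpolyX; apply/mnmP => j; rewrite mnmE !mnm1E.
by rewrite -[in RHS](permKV s j) (inj_eq perm_inj).
Qed.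

Lemma mpolyXU_sub_neq0 (i j : 'I_n) :
  i != j -> 'X_i - 'X_j != 0 :> {mpoly R[n]}.
Proof.
apply: contraNneq => /(congr1 (mcoeff U_(i))).
rewrite mcoeffB !mcoeffXU eqxx mcoeff0 eq_sym.
by case: eqP => // _ /eqP; rewrite subr0 oner_eq0.
Qed.

End MpolyExtra.

(** * Products of pairwise differences *)

Section PairProd.
Variables (F : numFieldType) (n m : nat).
Implicit Types (i j k : 'I_n) (p q : 'I_n * 'I_n).

Definition pair_diff p : {mpoly F[n]} := 'X_p.1 - 'X_p.2.

(** Ranging over ordered pairs makes the product visibly symmetric; up to sign it is the [2 * m]-th
    power of the Vandermonde product. *)
Definition pair_prod : {mpoly F[n]} := \prod_(p | p.1 != p.2) pair_diff p ^+ m.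

(* This is [pair_prod] divided by [pair_diff p], when [p.1 != p.2] and [0 < m]. *)
Definition pair_quo p : {mpoly F[n]} :=
  pair_diff p ^+ m.-1 * \prod_(q | (q.1 != q.2) && (q != p)) pair_diff q ^+ m.

Lemma msym_pair_diff (s : 'S_n) p : msym s (pair_diff p) = pair_diff (s p.1, s p.2).
Proof. by rewrite /pair_diff msymB !msymXU. Qed.

Lemma msym_pair_prod (s : 'S_n) : msym s pair_prod = pair_prod.
Proof.
rewrite /pair_prod rmorph_prod.
pose h p := (s p.1, s p.2).
have h_inj : injective h by case=> i j [i' j'] [/perm_inj -> /perm_inj ->].
rewrite [RHS](reindex_inj h_inj) /=.
apply: eq_big => [p|p _]; first by rewrite (inj_eq perm_inj).
by rewrite rmorphXn /= msym_pair_diff.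
Qed.

Lemma mderiv_pair_prod k :
  pair_prod^`M(k) = \sum_(p | p.1 != p.2) (m%:R * ((p.1 == k)%:R - (p.2 == k)%:R)) * pair_quo p.
Proof.
rewrite /pair_prod mderiv_prod; apply: eq_bigr => p _.
by rewrite mderivXn mderivB !mderivXU /pair_quo; ring.
Qed.

Hypothesis m_gt0 : (0 < m)%N.

Lemma pair_quoE p : p.1 != p.2 -> pair_diff p * pair_quo p = pair_prod.
Proof.
by move=> np; rewrite /pair_quo mulrA -exprS prednK // /pair_prod [RHS](bigD1 p).
Qed.

(** Both quotients, multiplied by their opposite differences, give [pair_prod]; the difference is
    then cancelled in an integral domain. *)
Lemma pair_quo_swap i j : i != j -> pair_quo (j, i) = - pair_quo (i, j).
Proof.
move=> ij; apply: (mulfI (mpolyXU_sub_neq0 F ij)).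
have eij : ('X_i - 'X_j) * pair_quo (i, j) = pair_prod.
  exact: (pair_quoE (p := (i, j))).
have eji : ('X_j - 'X_i) * pair_quo (j, i) = pair_prod.
  by rewrite -(pair_quoE (p := (j, i))) // eq_sym.
by rewrite mulrN eij -eji -mulNr opprB.
Qed.

Lemma msym_pair_quo (s : 'S_n) i j : i != j ->
  msym s (pair_quo (i, j)) = pair_quo (s i, s j).
Proof.
move=> ij; have sij : s i != s j by rewrite (inj_eq perm_inj).
apply: (mulfI (mpolyXU_sub_neq0 F sij)).
rewrite [RHS](pair_quoE (p := (s i, s j))) //.
rewrite -[RHS](msym_pair_prod s) -(pair_quoE (p := (i, j)) ij) msymM.
by rewrite msym_pair_diff.
Qed.

(** The pairs [(k, j)] and [(j, k)] contribute equally: the sign from the derivative is undone by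
    [pair_quo_swap], whence the factor [2]. *)
Lemma mderiv_pair_prodE k :
  pair_prod^`M(k) = (2 * m)%:R * \sum_(j | j != k) pair_quo (k, j).
Proof.
rewrite mderiv_pair_prod.
under eq_bigr => p _ do rewrite mulrBr mulrBl.
rewrite big_split /= sumrN.
pose Q i j := pair_quo (i, j).
have colk : \sum_(p : 'I_n * 'I_n | p.1 != p.2) m%:R * (p.1 == k)%:R * pair_quo p
   = m%:R * \sum_(j | j != k) Q k j.
  rewrite -(pair_big_dep xpredT (fun i j => i != j)
    (fun i j => m%:R * (i == k)%:R * Q i j)) /= (bigD1 k) //= eqxx.
  rewrite [X in _ + X]big1 ?addr0 => [|i /negPf ->]; last first.
    by rewrite big1 // => j _; rewrite mulr0 mul0r.
  rewrite mulr_sumr; apply: eq_big => [j|j _]; first by rewrite eq_sym.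
  by rewrite mulr1.
have rowk : \sum_(p : 'I_n * 'I_n | p.1 != p.2) m%:R * (p.2 == k)%:R * pair_quo p
   = - (m%:R * \sum_(j | j != k) Q k j).
  rewrite -(pair_big_dep xpredT (fun i j => i != j)
    (fun i j => m%:R * (j == k)%:R * Q i j)) /= (exchange_big_dep xpredT) //=.
  rewrite (bigD1 k) //= eqxx.
  rewrite [X in _ + X]big1 ?addr0 => [|i /negPf ->]; last first.
    by rewrite big1 // => j _; rewrite mulr0 mul0r.
  rewrite mulr_sumr -sumrN; apply: eq_bigr => j jk.
  by rewrite mulr1 /Q pair_quo_swap 1?eq_sym // mulrN.
by rewrite colk rowk opprK -mulrDl natrM mulr_natl mulr2n.
Qed.

End PairProd.

Section Aomoto.
Variables (F : numFieldType) (n m : nat) (x : {poly F}).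
Hypothesis m_gt0 : (0 < m)%N.
Implicit Types (A : {set 'I_n}) (i j k : 'I_n).
Local Notation P := (pair_prod F n m).
Local Notation Q := (pair_quo F (n := n) m).
Local Notation E := (star (fun=> x)).

Definition var_prod A : {mpoly F[n]} := \prod_(i in A) 'X_i.

Lemma star_const_msym s (p : {mpoly F[n]}) : E (msym s p) = E p.
Proof. exact: star_msym. Qed.

Lemma var_prod_setU1 k A : k \notin A -> var_prod (k |: A) = 'X_k * var_prod A.
Proof. by move=> kA; rewrite /var_prod big_setU1. Qed.

Lemma msym_var_prod (s : 'S_n) A : msym s (var_prod A) = \prod_(i in A) 'X_(s i).
Proof. by rewrite /var_prod rmorph_prod; apply: eq_bigr => i _ /=; rewrite msymXU. Qed.

Lemma mderiv_var_prod k A : k \notin A -> (var_prod A)^`M(k) = 0.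
Proof.
move=> kA; rewrite /var_prod mderiv_prod big1 // => i iA.
rewrite mderivXU; case: eqP => [ik|_]; last by rewrite mul0r.
by rewrite -ik iA in kA.
Qed.

Lemma tperm_var_prod k j A : k \notin A -> j \notin A -> msym (tperm k j) (var_prod A) = var_prod A.
Proof.
move=> kA jA; rewrite msym_var_prod; apply: eq_bigr => i iA.
have neq l : l \notin A -> l != i by apply: contraNneq => ->.
by rewrite tpermD ?neq.
Qed.

Lemma tperm_pair_quo k j : k != j -> msym (tperm k j) (Q (k, j)) = - Q (k, j).
Proof.
move=> kj; rewrite msym_pair_quo // tpermL tpermR.
exact: pair_quo_swap.
Qed.

(** Characteristic zero enters here; a value equal to its own opposite can then be shown to
    vanish. *)
Lemma poly_double_inj : injective (fun p : {poly F} => p + p).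
Proof.
move=> p q /eqP; rewrite -!mulr2n -!scaler_nat -subr_eq0 -scalerBr scaler_eq0.
by rewrite pnatr_eq0 subr_eq0 => /eqP.
Qed.

(* The argument of [E] changes sign when X_k and X_j are exchanged. *)
Lemma star_quo_in k j A : k \notin A -> j \in A -> E ('X_k * var_prod A * Q (k, j)) = 0.
Proof.
move=> kA jA; have kj : k != j by apply: contraNneq kA => ->.
have sym : msym (tperm k j) ('X_k * var_prod A) = 'X_k * var_prod A.
  have jD : j \notin A :\ j by rewrite setD11.
  have kD : k \notin A :\ j by rewrite !inE (negPf kA) andbF.
  rewrite -(setD1K jA) (var_prod_setU1 jD) 2!msymM 2!msymXU tpermL tpermR.
  by rewrite (tperm_var_prod kD jD) mulrCA.
apply: poly_double_inj; rewrite /= addr0 -{1}(star_const_msym (tperm k j)).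
rewrite msymM tperm_pair_quo // sym -starD mulrN addNr.
exact: star0.
Qed.

(* Here the exchange of X_k and X_j symmetrises X_k / (X_k - X_j) into 1/2. *)
Lemma star_quo_out k j A : k \notin A -> j \notin A -> k != j ->
  E ('X_k * var_prod A * Q (k, j)) *+ 2 = E (var_prod A * P).
Proof.
move=> kA jA kj.
rewrite mulr2n -{1}(star_const_msym (tperm k j)) msymM tperm_pair_quo //.
rewrite msymM tperm_var_prod // msymXU tpermL -starD; congr star.
by rewrite -(pair_quoE F m_gt0 (p := (k, j)) kj) /pair_diff /=; ring.
Qed.

(** Integrate by parts in [X_k]. In the derivative of [P], the terms with [j] in [A] vanish, and
    each of the [n - #|A| - 1] others contributes one half of [2 * m]. *)
Lemma aomoto_step k A : k \notin A ->
  E (var_prod (k |: A) * P) = (x - (m * (n - #|A|.+1))%:R) * E (var_prod A * P).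
Proof.
move=> kA; rewrite var_prod_setU1 // -mulrA star_mderiv mulrBl; congr (_ - _).
rewrite mderivM mderiv_var_prod // mul0r add0r mderiv_pair_prodE //.
have -> : 'X_k * (var_prod A * ((2 * m)%:R * \sum_(j | j != k) Q (k, j)))
  = (2 * m)%:R *: \sum_(j | j != k) ('X_k * var_prod A * Q (k, j)).
  by rewrite -mulr_sumr scaler_nat -mulr_natl; ring.
rewrite starZ star_sum (bigID (mem A)) /=.
rewrite [X in X + _]big1 ?add0r => [|j /andP[_ jA]]; last exact: star_quo_in.
rewrite mulnC natrM -scalerA scaler_sumr.
rewrite (eq_bigr (fun=> E (var_prod A * P))); last first.
  by move=> j /andP[jk jA]; rewrite scaler_nat star_quo_out // eq_sym.
rewrite (eq_bigl (mem (~: (k |: A)))) => [|j]; last by rewrite !inE negb_or.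
rewrite sumr_const cardsCs setCK card_ord cardsU1 kA add1n -scaler_nat scalerA.
by rewrite -natrM scaler_nat mulr_natl.
Qed.

End Aomoto.

(** * The discrete Selberg evaluation *)

Section Shift.
Variables (F : numFieldType) (n m : nat) (x : {poly F}).
Hypothesis m_gt0 : (0 < m)%N.
Implicit Types (A : {set 'I_n}).
Local Notation P := (pair_prod F n m).

Lemma star_var_prod A :
  star (fun=> x) (var_prod F A * P) =
  \prod_(r < #|A|) (x - (m * (n - r.+1))%:R) * star (fun=> x) P.
Proof.
have [c] := ubnP #|A|; elim: c A => // c IH A le_Ac.
have [->|[k kA]] := set_0Vmem A.
  by rewrite cards0 big_ord0 mul1r /var_prod big_set0 mul1r.
have kAk : k \notin A :\ k by rewrite setD11.
rewrite -(setD1K kA) aomoto_step // IH; last first.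
  by rewrite (cardsD1 k A) kA add1n ltnS in le_Ac.
by rewrite mulrA cardsU1 kAk add1n big_ord_recr /= [_ * (x - _)]mulrC.
Qed.

Lemma var_prodE A : var_prod F A = 'X_[[multinom (i \in A : nat) | i < n]].
Proof.
rewrite mpolyXE_id /var_prod big_mkcond; apply: eq_bigr => i _; rewrite mnmE.
by case: (i \in A).
Qed.

Lemma star_var_prod_shift A (p : {mpoly F[n]}) :
  star (fun=> x) (var_prod F A * p) =
  x ^+ #|A| * star (fun i => x - (i \in A)%:R) p.
Proof.
rewrite var_prodE star_mulX; congr (_ * _); last first.
  by apply: eq_star => i; rewrite mnmE.
rewrite -prodr_const [RHS]big_mkcond; apply: eq_bigr => i _; rewrite mnmE.
by case: (i \in A); rewrite ?ffact0 // ffact_recl ffact0 mulr1.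
Qed.

(** Two evaluations of the same value are equated: one shifts the arguments, the other iterates
    Aomoto's recurrence. *)
Lemma star_shift A :
  x ^+ #|A| * star (fun i => x - (i \in A)%:R) P =
  \prod_(r < #|A|) (x - (m * (n - r.+1))%:R) * star (fun=> x) P.
Proof. by rewrite -star_var_prod_shift star_var_prod. Qed.

End Shift.

Lemma signZ (R : comNzRingType) (A : lalgType R) k (u : A) :
  (-1) ^+ k *: u = (-1) ^+ k * u.
Proof. by rewrite -signr_odd -[in RHS]signr_odd scaler_sign mulr_sign. Qed.

Lemma pair_prodE (F : numFieldType) n m :
  pair_prod F n m = \prod_(i < n) \prod_(j < n | i != j) ('X_i - 'X_j) ^+ m.
Proof.
by rewrite (pair_big_dep xpredT (fun i j => i != j)
  (fun i j => ('X_i - 'X_j) ^+ m : {mpoly F[n]})).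
Qed.

(** The pairs [(0, j)] and [(j, 0)] become [(- X_j) ^+ m] and [X_j ^+ m]; the remaining pairs form
    the product in [n] variables. *)
Lemma specialize0_pair_prod (F : numFieldType) n m :
  specialize0 (pair_prod F n.+1 m) =
  (-1) ^+ (m * n) * ('X_[[multinom (2 * m)%N | i < n]] * pair_prod F n m).
Proof.
pose sp := specialize0 (F := F) (n := n).
have sp0 : sp 'X_ord0 = 0.
  by rewrite /sp /specialize0 comp_mpolyXU -tnth_nth tnth_mktuple unlift_none.
have spS j : sp 'X_(lift ord0 j) = 'X_j.
  by rewrite /sp /specialize0 comp_mpolyXU -tnth_nth tnth_mktuple liftK.
have spE i j : sp (('X_i - 'X_j) ^+ m) = (sp 'X_i - sp 'X_j) ^+ m.
  by rewrite /sp /specialize0 rmorphXn rmorphB.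
have -> : specialize0 (pair_prod F n.+1 m) =
    \prod_(i < n.+1) \prod_(j < n.+1 | i != j) sp (('X_i - 'X_j) ^+ m).
  rewrite pair_prodE /specialize0 rmorph_prod; apply: eq_bigr => i _.
  by rewrite /= rmorph_prod.
rewrite big_ord_recl [X in X * _]big_mkcond [X in X * _]big_ord_recl eqxx /= mul1r.
under eq_bigr => j _ do rewrite spE sp0 spS sub0r exprNn.
rewrite big_split /= prodr_const card_ord -exprM -mulrA; congr (_ * _).
rewrite pair_prodE mpolyXE_id -!big_split /=; apply: eq_bigr => i _.
rewrite [X in _ * X]big_mkcond [X in _ * X]big_ord_recl /= spE sp0 spS
  subr0 mnmE mulrA -exprD addnn.
rewrite -mul2n; congr (_ * _); rewrite [RHS]big_mkcond.
by apply: eq_bigr => j _; rewrite (inj_eq lift_inj) spE !spS.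
Qed.

(* The ratio p / q is 1-periodic, hence constant on the integers from N0 on. *)
Lemma eq_scale_of_shift (F : numFieldType) (p q : {poly F}) N0 :
  (forall N, (N0 <= N)%N -> q.[N%:R] != 0) ->
  (p \Po ('X - 1)) * q = (q \Po ('X - 1)) * p -> exists c, p = c *: q.
Proof.
move=> q_neq0 pq; exists (p.[N0%:R] / q.[N0%:R]).
have ev d : p.[(N0 + d)%:R] = p.[N0%:R] / q.[N0%:R] * q.[(N0 + d)%:R].
  elim: d => [|d IH]; first by rewrite addn0 divfK ?q_neq0.
  have /(congr1 (horner^~ (N0 + d.+1)%:R)) := pq.
  rewrite !hornerM !horner_comp !hornerE addnS -natr1 addrK IH natr1 -addnS.
  move=> e; apply: (mulfI (q_neq0 _ (leq_addr d N0))).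
  by rewrite -e; ring.
apply/eqP; rewrite -subr_eq0; apply/eqP; set r := p - _.
apply: (@roots_geq_poly_eq0 _ r [seq (N0 + d)%:R | d <- iota 0 (size r)]).
- apply/allP => _ /mapP[d _ ->]; rewrite rootE /r hornerD hornerN hornerZ ev.
  by rewrite subrr.
- rewrite map_inj_uniq ?iota_uniq // => d e /eqP.
  by rewrite eqr_nat eqn_add2l => /eqP.
- by rewrite size_map size_iota.
Qed.

Section Selberg.
Variables (F : numFieldType) (m : nat).
Hypothesis m_gt0 : (0 < m)%N.
Implicit Types (n r : nat).
Let D n : {poly F} := star (fun=> 'X) (pair_prod F n m).
Let T n : {poly F} := \prod_(r < n) ffact 'X (r * m).
Let fN1 r : F := ffact (-1) (r * m).

(** Both sides are [(x)_(r+1)], with its first or its last factor split off. *)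
Lemma ffact_X_shift r :
  'X * (ffact 'X r \Po ('X - 1)) = ('X - r%:R) * ffact 'X r :> {poly F}.
Proof.
rewrite (rmorph_ffact (comp_poly ('X - 1))) /= comp_polyX -ffact_recl ffactS.
by rewrite mulrC.
Qed.

Lemma prod_ffact_shift n :
  'X ^+ n * (T n \Po ('X - 1)) = \prod_(r < n) ('X - (r * m)%:R) * T n.
Proof.
rewrite /T rmorph_prod -[n in 'X ^+ n]card_ord -prodr_const -!big_split /=.
by apply: eq_bigr => r _; rewrite ffact_X_shift.
Qed.

Lemma star_pair_prod_shift n :
  'X ^+ n * (D n \Po ('X - 1)) = \prod_(r < n) ('X - (r * m)%:R) * D n.
Proof.
have := star_shift 'X m_gt0 [set: 'I_n]; rewrite cardsT card_ord.
rewrite (reindex_inj rev_ord_inj) /= /D star_comp => e.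
rewrite (eq_star (w := fun i => 'X - (i \in [set: 'I_n])%:R)) => [|i].
  rewrite e; congr (_ * _); apply: eq_bigr => r _.
  by rewrite mulnC.
by rewrite comp_polyX inE.
Qed.

(** All roots of [T n] are natural numbers below [n * m]. *)
Lemma prod_ffact_horner_neq0 n N : (n * m <= N)%N -> (T n).[N%:R] != 0.
Proof.
move=> le_N; rewrite /T horner_prod; apply/prodf_neq0 => r _.
rewrite /ffact horner_prod.
apply/prodf_neq0 => k _; rewrite -polyC_natr !hornerE subr_eq0 eqr_nat gtn_eqF //.
apply: leq_trans le_N; apply: leq_trans (ltn_ord k) _.
by rewrite leq_mul2r (ltnW (ltn_ord r)) orbT.
Qed.

(** [D n] and [T n] satisfy the same shift equation, so [eq_scale_of_shift] applies once ['X ^+ n]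
    is cancelled. *)
Lemma star_pair_prod_proportional n : exists c, D n = c *: T n.
Proof.
apply: (eq_scale_of_shift (N0 := n * m)) => [N|]; first exact: prod_ffact_horner_neq0.
have Xn_neq0 : 'X ^+ n != 0 :> {poly F} by rewrite expf_neq0 ?polyX_eq0.
by apply: (mulfI Xn_neq0); rewrite !mulrA star_pair_prod_shift prod_ffact_shift; ring.
Qed.

Lemma fN1_neq0 r : fN1 r != 0.
Proof.
by rewrite /fN1 ffactN1 mulf_neq0 ?signr_eq0 // pnatr_eq0 -lt0n fact_gt0.
Qed.

Lemma prod_ffact_succ n :
  T n.+1 * \prod_(r < n) ('X - (r.+1 * m)%:R) =
  'X ^+ n * \prod_(r < n) ffact ('X - 1) (r.+1 * m).
Proof.
rewrite /T big_ord_recl mul0n ffact0 mul1r.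
rewrite -[n in 'X ^+ n]card_ord -prodr_const -!big_split /=.
by apply: eq_bigr => r _; rewrite -ffact_recl ffactS.
Qed.

(** With [A] all indices but [ord0], [star_shift] is divided by ['X ^+ n] and evaluated at [0]: the
    first variable gets argument [0] and drops out, while the others get [-1]. *)
Lemma star_pair_prod_ratio_succ n c k : D n = c *: T n -> D n.+1 = k *: T n.+1 ->
  k * \prod_(r < n) fN1 r.+1 =
  (-1) ^+ (m * n) * c * \prod_(r < n) fN1 r.+2.
Proof.
move=> Dc Dk; pose A : {set 'I_n.+1} := ~: [set ord0].
have cA : #|A| = n by rewrite cardsC1 card_ord.
pose w i : {poly F} := 'X - (i \in A)%:R.
have e1 : star w (pair_prod F n.+1 m) = k *: \prod_(r < n) ffact ('X - 1) (r.+1 * m).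
  have Xn_neq0 : 'X ^+ n != 0 :> {poly F} by rewrite expf_neq0 ?polyX_eq0.
  apply: (mulfI Xn_neq0); have := star_shift 'X m_gt0 A.
  rewrite cA => ->; rewrite -/(D n.+1) Dk -!scalerAr -prod_ffact_succ.
  congr (_ *: _); rewrite mulrC; congr (_ * _).
  rewrite (reindex_inj rev_ord_inj) /=; apply: eq_bigr => r _.
  by rewrite subnSK ?ltn_ord // subSn ?leq_subr // subKn 1?ltnW // mulnC.
have := congr1 (comp_poly 0) e1; rewrite star_comp star_specialize0; last first.
  by rewrite /w !inE eqxx subr0 comp_polyX.
rewrite (eq_star (w := fun=> -1)) => [|i]; last first.
  by rewrite /w !inE comp_polyB comp_polyX rmorph1 sub0r.
rewrite specialize0_pair_prod -signZ starZ star_mulX.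
(* The argument [-1 - 2m], left by the monomial with exponents [2 * m], is written as a composition
   so that [star_comp] recovers [D n]. *)
rewrite (eq_star (w := fun=> 'X \Po (- 1 - (2 * m)%:R))) => [|i]; last first.
  by rewrite mnmE comp_polyX.
rewrite -star_comp -/(D n) Dc !comp_polyZ !rmorph_prod /=.
rewrite -scalerAr -big_split /= scalerA => e2.
apply: polyC_inj; rewrite !polyCM !rmorph_prod /=.
have fP r : (fN1 r)%:P = ffact (-1) (r * m) by rewrite /fN1 rmorph_ffact rmorphN1.
rewrite -polyCM !mul_polyC.
transitivity (k *: \prod_(r < n) (ffact ('X - 1) (r.+1 * m) \Po 0)).
  congr (_ *: _); apply: eq_bigr => r _; rewrite fP (rmorph_ffact (comp_poly 0)).
  by rewrite /= comp_polyB comp_polyX rmorph1 sub0r.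
rewrite -e2; congr (_ *: _); apply: eq_bigr => r _; rewrite fP mnmE.
(* Here [(-1)_(2m) (-1 - 2m)_(rm) = (-1)_((r+2)m)]. *)
by rewrite (rmorph_ffact (comp_poly _)) /= comp_polyX -ffactD -mulnDl.
Qed.

(** By telescoping, consecutive constants have ratio [(-1)_((n+1)m) / (-1)_m] up to sign, which is
    [((n+1)m)! / m!] up to sign. *)
Lemma star_pair_prod n :
  star (fun=> 'X) (pair_prod F n m) =
  (\prod_(k < n) (((k.+1 * m)`!)%:R / (m`!)%:R)) *: \prod_(r < n) ffact 'X (r * m).
Proof.
elim: n => [|n IH].
  rewrite !big_ord0 scale1r /pair_prod big1 => [|[[]] //].
  by rewrite -mpolyX0 starX big_ord0.
have [k Dk] := star_pair_prod_proportional n.+1; rewrite -/(D _) Dk; congr (_ *: _).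
have := star_pair_prod_ratio_succ IH Dk.
have mf_neq0 : (m`!)%:R != 0 :> F by rewrite pnatr_eq0 -lt0n fact_gt0.
have G_neq0 : \prod_(r < n) fN1 r.+2 != 0 by apply/prodf_neq0 => r _; exact: fN1_neq0.
have telescope : \prod_(r < n) fN1 r.+1 * fN1 n.+1 = fN1 1 * \prod_(r < n) fN1 r.+2.
  transitivity (\prod_(r < n.+1) fN1 r.+1); first by rewrite big_ord_recr.
  by rewrite big_ord_recl.
set c := \prod_(k < n) (_ / _); set G := \prod_(r < n) _ in G_neq0 telescope *.
move=> e.
have {}e : k * fN1 1 = (-1) ^+ (m * n) * c * fN1 n.+1.
  by apply: (mulIf G_neq0); rewrite -[LHS]mulrA -telescope mulrA e; ring.
rewrite big_ord_recr /= -/c; apply: (mulIf mf_neq0); rewrite -mulrA divfK //.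
apply: (@mulfI _ ((-1) ^+ m)); first by rewrite signr_eq0.
move: e; rewrite /fN1 !ffactN1 mul1n => e.
rewrite [LHS]mulrCA e.
rewrite mulSn exprD [(m * n)%N]mulnC.
(* One sign [(-1) ^+ (n * m)] comes from the recurrence and another from [ffactN1]; they cancel. *)
have := sqrr_sign F (n * m).
move: ((-1) ^+ (n * m)) ((-1) ^+ m) ((m + n * m)`!%:R) => u s f uu.
transitivity (u ^+ 2 * (s * (c * f))); first by ring.
by rewrite uu mul1r.
Qed.

End Selberg.

(** * Antisymmetrisation *)

Section Vandermonde.
Variable S : comNzRingType.
Implicit Types (n : nat).

Definition vand n (b : 'I_n -> S) := \prod_(i < n) \prod_(j < n | (i < j)%N) (b j - b i).

Lemma vand_det n (b : 'I_n -> S) : vand b = \det (Vandermonde n (\row_j b j)).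
Proof.
rewrite det_Vandermonde; apply: eq_bigr => i _; apply: eq_bigr => j _.
by rewrite !mxE.
Qed.

Lemma vandE n (b : 'I_n -> S) :
  vand b = \sum_(s : 'S_n) (-1) ^+ s * \prod_(i < n) b (s i) ^+ i.
Proof.
rewrite vand_det; apply: eq_bigr => s _; congr (_ * _).
by apply: eq_bigr => i _; rewrite !mxE.
Qed.

Lemma vand_perm n (b : 'I_n -> S) (s : 'S_n) : vand (b \o s) = (-1) ^+ s * vand b.
Proof.
rewrite !vand_det; have -> : Vandermonde n (\row_j (b \o s) j)
    = col_perm s (Vandermonde n (\row_j b j)).
  by apply/matrixP => i j; rewrite !mxE.
by rewrite col_permE det_mulmx det_perm odd_permV mulrC.
Qed.

Lemma prod_ltn_const n (c : S) :
  \prod_(i < n) \prod_(j < n | (i < j)%N) c = c ^+ 'C(n, 2).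
Proof.
elim: n => [|n IH]; first by rewrite big_ord0.
rewrite big_ord_recl big_mkcond big_ord_recl /= mul1r prodr_const card_ord.
rewrite binS bin1 exprD mulrC -IH; congr (_ * _); apply: eq_bigr => i _.
by rewrite [LHS]big_mkcond big_ord_recl /= mul1r [RHS]big_mkcond.
Qed.

Lemma prod_gtn n (f : 'I_n -> 'I_n -> S) :
  \prod_(i < n) \prod_(j < n | (j < i)%N) f i j =
  \prod_(i < n) \prod_(j < n | (i < j)%N) f j i.
Proof. by rewrite (exchange_big_dep xpredT). Qed.

(** Reversal changes the sign of each of the ['C(n, 2)] factors. *)
Lemma vand_rev n (b : 'I_n -> S) :
  vand (b \o @rev_ord n) = (-1) ^+ 'C(n, 2) * vand b.
Proof.
transitivity (\prod_(i < n) \prod_(j < n | (j < i)%N) (b j - b i)).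
  rewrite /vand (reindex_inj rev_ord_inj); apply: eq_bigr => i _.
  rewrite (reindex_inj rev_ord_inj); apply: eq_big => [j|j _] /=.
    by rewrite ltn_sub2lE.
  by rewrite !rev_ordK.
rewrite prod_gtn -prod_ltn_const -big_split; apply: eq_bigr => i _ /=.
by rewrite -big_split; apply: eq_bigr => j _; rewrite /= mulN1r opprB.
Qed.

End Vandermonde.

Section Antisymmetry.
Variables (F : numFieldType) (n m : nat) (x : {poly F}).
Hypothesis m_gt0 : (0 < m)%N.
Let X (i : 'I_n) : {mpoly F[n]} := 'X_i.
Let k := (2 * m - 1)%N.
Let E := star (fun=> x) (\prod_(i < n) X i ^+ i * vand X ^+ k).

(** The two orders of a pair [i < j] combine to [(-1) ^+ m * (X_j - X_i) ^+ (2 * m)]. *)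
Lemma pair_prod_vand : pair_prod F n m = (-1) ^+ (m * 'C(n, 2)) * vand X ^+ (2 * m).
Proof.
rewrite pair_prodE exprM -prod_ltn_const.
under eq_bigr => i _ do rewrite (bigID (fun j : 'I_n => (i < j)%N)) /=.
rewrite big_split /=.
have -> : \prod_(i < n) \prod_(j < n | (i != j) && (i < j)%N) ('X_i - 'X_j) ^+ m
  = \prod_(i < n) \prod_(j < n | (i < j)%N) ('X_i - 'X_j) ^+ m :> {mpoly F[n]}.
  apply: eq_bigr => i _; apply: eq_bigl => j.
  by rewrite ltn_neqAle andbA andbb.
have -> : \prod_(i < n) \prod_(j < n | (i != j) && ~~ (i < j)%N) ('X_i - 'X_j) ^+ m
  = \prod_(i < n) \prod_(j < n | (j < i)%N) ('X_i - 'X_j) ^+ m :> {mpoly F[n]}.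
  apply: eq_bigr => i _; apply: eq_bigl => j.
  by rewrite -leqNgt ltn_neqAle eq_sym.
rewrite prod_gtn /vand -prodrXl -!big_split /=; apply: eq_bigr => i _.
rewrite -prodrXl -!big_split /=.
apply: eq_bigr => j _; rewrite mul2n -addnn exprD mulrA.
by rewrite -exprNn opprB.
Qed.

Lemma msym_vand (s : 'S_n) : msym s (vand X) = vand (X \o s).
Proof.
rewrite /vand rmorph_prod; apply: eq_bigr => i _ /=.
by rewrite rmorph_prod; apply: eq_bigr => j _ /=; rewrite msymB !msymXU.
Qed.

(** The exponent [k = 2m - 1] is odd because [m] is positive. *)
Lemma sign_odd_pow e : ((-1) ^+ e) ^+ k = (-1) ^+ e :> {mpoly F[n]}.
Proof.
rewrite -exprM mulnC exprM -[in LHS]signr_odd; congr (_ ^+ e).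
by rewrite /k oddB ?muln_gt0 // oddM.
Qed.

(** Renaming the variables preserves the value at equal arguments and changes the odd power of
    [vand X] by the sign. The sign is given by an exponent [e] to cover both the signature of [s]
    and the form ['C(n, 2)]. *)
Lemma star_antisym (s : 'S_n) e : vand (X \o s) = (-1) ^+ e * vand X ->
  star (fun=> x) (\prod_(i < n) X (s i) ^+ i * vand X ^+ k) = (-1) ^+ e *: E.
Proof.
move=> se; rewrite /E -[in RHS](star_const_msym _ s) msymM rmorphXn /= msym_vand se.
rewrite exprMn sign_odd_pow mulrCA -signZ starZ scalerA -exprD addnn -mul2n.
rewrite exprM sqrrN !expr1n scale1r rmorph_prod.
congr (star _ (_ * _)); apply: eq_bigr => i _.
by rewrite rmorphXn /= msymXU.
Qed.

(** In the Leibniz expansion each signature meets the equal sign from [star_antisym]; their product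
    is [1], so the determinant turns into a permanent. *)
Lemma star_vand_scaled (a : 'I_n -> F) :
  star (fun=> x) (vand (fun i => a i *: X i) * vand X ^+ k) =
  per (\matrix_(i < n, j < n) a j ^+ i) *: E.
Proof.
rewrite vandE mulr_suml star_sum /per scaler_suml; apply: eq_bigr => s _.
have -> : \prod_(i < n) (a (s i) *: X (s i)) ^+ i =
    (\prod_(i < n) a (s i) ^+ i) *: \prod_(i < n) X (s i) ^+ i.
  by rewrite -scaler_prod; apply: eq_bigr => i _; rewrite exprZn.
rewrite -scalerAr -scalerAl -signZ -scalerAl !starZ.
rewrite (star_antisym (vand_perm X s)) !scalerA; congr (_ *: _).
rewrite -mulrA -expr2 sqrr_sign mulr1.
by apply: eq_bigr => i _; rewrite mxE.
Qed.

(** This is the case of all [a i = 1], where the permanent counts the permutations. *)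
Lemma star_pair_prod_antisym :
  star (fun=> x) (pair_prod F n m) = ((-1) ^+ (m * 'C(n, 2)) * (n`!)%:R) *: E.
Proof.
have := star_vand_scaled (fun=> 1).
have -> : per (\matrix_(i < n, j < n) 1 ^+ i : 'M[F]_n) = (n`!)%:R.
  rewrite /per (eq_bigr (fun=> 1)) => [|s _].
    by rewrite sumr_const card_Sn.
  by rewrite big1 // => i _; rewrite mxE expr1n.
have -> : vand (fun i => 1 *: X i) = vand X.
  by apply: eq_bigr => i _; apply: eq_bigr => j _; rewrite !scale1r.
rewrite -exprS pair_prod_vand -signZ starZ -scalerA => <-.
by rewrite /k subn1 prednK ?muln_gt0.
Qed.

End Antisymmetry.

(** * The two identities *)

Section Identities.
Variables (F : numFieldType) (n m : nat).
Hypothesis m_gt0 : (0 < m)%N.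
Let X (i : 'I_n) : {mpoly F[n]} := 'X_i.
Let k := (2 * m - 1)%N.
Let T : {poly F} := \prod_(r < n) ffact 'X (r * m).
Let K : F := (\prod_(r < n) ((r.+1 * m)`!)%:R) / (((m`!) ^ n * n`!)%:R).

Lemma star_top : star (fun=> 'X) (\prod_(i < n) X i ^+ i * vand X ^+ k) =
  ((-1) ^+ (m * 'C(n, 2)) * K) *: T.
Proof.
have nf_neq0 : (n`!)%:R != 0 :> F by rewrite pnatr_eq0 -lt0n fact_gt0.
have s_neq0 : (-1) ^+ (m * 'C(n, 2)) * (n`!)%:R != 0 :> F.
  by rewrite mulf_neq0 ?signr_eq0.
apply: (scalerI s_neq0); rewrite -star_pair_prod_antisym // star_pair_prod //.
rewrite scalerA; congr (_ *: _); rewrite mulrACA -expr2 sqrr_sign mul1r.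
rewrite /K natrM natrX prodf_div prodr_const card_ord invfM.
by rewrite [_^-1 * _]mulrC mulrCA mulVKf.
Qed.

Lemma star_scaled_vand_prod (a : 'I_n -> F) :
  star (fun=> 'X) (\prod_(i < n) \prod_(j < n | (i < j)%N)
     ((a j *: 'X_j - a i *: 'X_i) * ('X_j - 'X_i) ^+ k)) =
  ((-1) ^+ (m * 'C(n, 2)) * K * per (\matrix_(i < n, j < n) a j ^+ i)) *: T.
Proof.
have -> : \prod_(i < n) \prod_(j < n | (i < j)%N)
     ((a j *: 'X_j - a i *: 'X_i) * ('X_j - 'X_i) ^+ k) =
     vand (fun i => a i *: X i) * vand X ^+ k.
  rewrite /vand -prodrXl -big_split; apply: eq_bigr => i _ /=.
  by rewrite -prodrXl -big_split.
rewrite star_vand_scaled // star_top scalerA; congr (_ *: _).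
by rewrite mulrC.
Qed.

(** The monomial with exponents [n - 1 - i] is the reversal of the one in [star_top]. By [star_mulX]
    it produces both the shifted arguments and the product of the [(x)_r]. *)
Lemma star_vand_mul :
  star (fun i : 'I_n => 'X - (n - 1 - i)%:R) (vand X ^+ k) * \prod_(r < n) ffact 'X r =
  ((-1) ^+ ((m - 1) * 'C(n, 2)) * K) *: T.
Proof.
pose s := perm (@rev_ord_inj n).
have se : vand (X \o s) = (-1) ^+ 'C(n, 2) * vand X.
  rewrite -vand_rev; apply: eq_bigr => i _; apply: eq_bigr => j _.
  by rewrite /= !permE.
have := star_antisym 'X m_gt0 se; rewrite star_top scalerA mulrA -exprD.
(* The exponents [(m + 1) 'C(n, 2)] and [(m - 1) 'C(n, 2)] have the same parity. *)
have sgn : (-1) ^+ ('C(n, 2) + m * 'C(n, 2)) = (-1) ^+ ((m - 1) * 'C(n, 2)) :> F.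
  by case: m m_gt0 => // m' _; rewrite subn1 /= mulSn addnA addnn exprD -mul2n exprM
    sqrrN !expr1n mul1r.
rewrite sgn => <-.
have -> : \prod_(i < n) X (s i) ^+ i = 'X_[[multinom (n - 1 - i)%N | i < n]].
  rewrite mpolyXE_id (reindex_inj (@perm_inj _ s)) /=; apply: eq_bigr => i _.
  rewrite mnmE !permE rev_ordK /=; congr (_ ^+ _).
  by rewrite -subnDA add1n.
rewrite star_mulX mulrC; congr (_ * _).
  rewrite (reindex_inj rev_ord_inj); apply: eq_bigr => i _ /=.
  by rewrite mnmE -subnDA add1n.
by apply: eq_star => i; rewrite mnmE.
Qed.

Lemma ffact_X_neq0 r : ffact 'X r != 0 :> {poly F}.
Proof.
by apply/prodf_neq0 => i _; rewrite -polyC_natr polyXsubC_eq0.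
Qed.

(** The division is exact: [star_vand_mul] shows that the scaled numerator is a multiple of the
    nonzero denominator. *)
Lemma star_vand_prod :
  star (fun i : 'I_n => 'X - (n - 1 - i)%:R%:P)
    (\prod_(i < n) \prod_(j < n | (i < j)%N) ('X_j - 'X_i) ^+ k) =
  ((-1) ^+ ((m - 1) * 'C(n, 2)) * K) *: (T %/ \prod_(r < n) ffact 'X r).
Proof.
have -> : \prod_(i < n) \prod_(j < n | (i < j)%N) ('X_j - 'X_i) ^+ k = vand X ^+ k.
  by rewrite /vand -prodrXl; apply: eq_bigr => i _; rewrite -prodrXl.
rewrite (eq_star (w := fun i : 'I_n => 'X - (n - 1 - i)%:R)) => [|i]; last first.
  by rewrite polyC_natr.
rewrite -divpZl -star_vand_mul mulpK //.
by apply/prodf_neq0 => r _; apply: ffact_X_neq0.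
Qed.

End Identities.

Unset Implicit Arguments.
Set Strict Implicit.

(* The complex numbers are R[i] for R : realType (the reals).  Indices are
   0-based: paper's x_{i+1} is 'X_i, paper's a_{j+1} is a j. *)
Theorem theorem2p2 (R : realType) (n m : nat) (a : 'I_n -> R[i]) :
  (1 <= n)%N -> (1 <= m)%N ->
  let x : {poly R[i]} := 'X in
  let K : R[i] := (\prod_(k < n) ((k.+1 * m)`!)%:R) / (((m`!) ^ n * n`!)%:R) in
  (* first identity: evaluation at x_{i+1} = x - n + (i+1) *)
  star_eval (\prod_(i < n) \prod_(j < n | (i < j)%N) ('X_j - 'X_i) ^+ (2 * m - 1))
      (fun i : 'I_n => x - (n - 1 - i)%:R%:P)
    = ((-1) ^+ ((m - 1) * 'C(n, 2)) * K)%:P *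
      ((\prod_(r < n) ffact x (r * m)) %/ (\prod_(r < n) ffact x r))
  /\
  (* second identity: evaluation at x_1 = ... = x_n = x *)
  star_eval (\prod_(i < n) \prod_(j < n | (i < j)%N)
               ((a j *: 'X_j - a i *: 'X_i) * ('X_j - 'X_i) ^+ (2 * m - 1)))
      (fun _ : 'I_n => x)
    = ((-1) ^+ (m * 'C(n, 2)) * K * per (\matrix_(i < n, j < n) a j ^+ i))%:P *
      \prod_(r < n) ffact x (r * m).
Proof.
move=> _ m_gt0 x K; split; rewrite mul_polyC.
  exact: star_vand_prod.
exact: star_scaled_vand_prod.
Qed.
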